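(* If $M$ is a $C^{1,1}$ submanifold of $\mathbb{R}^d$ and the topological skeleton $\mathcal{S}(M^c)$ of $M^c=\mathbb{R}^d\setminus M$ is closed in $\mathbb{R}^d$, then the frontier function $\vartheta:\nu_1(M)\to(0,\infty]$ of $M$ is continuous.
   Context: Submanifolds are nonempty. Let $0\le m<d$. A set $M\subseteq\mathbb{R}^d$ is an $m$-dimensional $C^k$ submanifold of $\mathbb{R}^d$ if for every $\xi\in M$ there are open sets $U,V\subseteq\mathbb{R}^d$ with $\xi\in U$ and a $C^k$ diffeomorphism $\Psi:V\to U$ such that for all $y\in V$: $\Psi(y)\in M\iff y_{m+1}=\dots=y_d=0$. The case $m=d$ is excluded throughout. $T_\xi(M)$ denotes the tangent space (a linear subspace of $\mathbb{R}^d$). Let $S$ be the unit sphere of $\mathbb{R}^d$. For $m$-dimensional linear subspaces $T_1,T_2$ put $d_H(T_1,T_2):=\sup_{t_1\in T_1\cap S}\inf_{t_2\in T_2\cap S}\|t_2-t_1\|$. For $m\ge1$, $M$ is an $m$-dimensional $C^{1,1}$ submanifold if it is an $m$-dimensional $C^1$ submanifold and $\xi\mapsto T_\xi(M)$ is locally Lipschitz with respect to $d_H$: every point of $M$ has a relatively open neighborhood $V\subseteq M$ and a constant $L>0$ with $d_H(T_\zeta(M),T_\eta(M))\le L\|\zeta-\eta\|$ for all $\zeta,\eta\in V$. $d(x,M)=\inf_{\xi\in M}\|x-\xi\|$ (Euclidean norm). $\operatorname{unpp}(M)$ is the set of $x\in\mathbb{R}^d$ for which there is exactly one $\xi\in M$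 with $\|x-\xi\|=d(x,M)$. $\mathcal{E}(M)$ is the interior of $\operatorname{unpp}(M)$. $\nu_1(M):=\{(\xi,v)\in\mathbb{R}^d\times\mathbb{R}^d:\xi\in M,\ v\perp T_\xi(M),\ \|v\|=1\}$ with the subspace topology. The frontier function is $\vartheta(\xi,v):=\sup\{r>0:\ ]\xi,\xi+rv[\ \subseteq\mathcal{E}(M)\}\in(0,\infty]$, where $]a,b[$ is the open line segment $\{(1-\lambda)a+\lambda b:\lambda\in(0,1)\}$. $B_r(x)$ is the open ball with center $x$ and radius $r$. For $A\subseteq\mathbb{R}^d$, a ball $B_r(x)$ with $r\in(0,\infty)$ is maximal in $A$ if $B_r(x)\subseteq A$ and, whenever $x'\in\mathbb{R}^d$, $r'\in(0,\infty)$ and $B_r(x)\subseteq B_{r'}(x')\subseteq A$, then $r'=r$ and $x'=x$. The topological skeleton is $\mathcal{S}(A):=\{x\in\mathbb{R}^d:\exists r\in(0,\infty)\text{ such that }B_r(x)\text{ is maximal in }A\}$. *)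

(* Defs.v *)
(* MathComp / MathComp-Analysis, over an abstract R : realType. *)
From HB Require Import structures.
From mathcomp Require Import all_boot all_order all_algebra.
From mathcomp Require Import all_classical all_reals all_analysis.

Set Implicit Arguments.
Unset Strict Implicit.
Unset Printing Implicit Defensive.

Import Order.TTheory GRing.Theory Num.Theory.
Import numFieldNormedType.Exports.

Local Open Scope classical_set_scope.
Local Open Scope ring_scope.

(* R^d is 'rV[R]_d.  The library norm `|x| on 'rV[R]_d is the sup norm: it
   induces the usual topology, but every metric notion below is Euclidean and
   uses norm2 instead. *)
Definition dotp (R : realType) (d : nat) (u v : 'rV[R]_d) : R :=
  \sum_(i < d) u 0 i * v 0 i.

Definition norm2 (R : realType) (d : nat) (u : 'rV[R]_d) : R :=
  Num.sqrt (dotp u u).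

Definition unit_sphere (R : realType) (d : nat) : set 'rV[R]_d :=
  [set u | norm2 u = 1].

Definition ball2 (R : realType) (d : nat) (x : 'rV[R]_d) (r : R) :
    set 'rV[R]_d :=
  [set y | norm2 (y - x) < r].

Definition open_segment (R : realType) (d : nat) (a b : 'rV[R]_d) :
    set 'rV[R]_d :=
  [set (1 - l) *: a + l *: b | l in [set l : R | 0 < l < 1]].

Definition C1_on (R : realType) (d : nat) (V : set 'rV[R]_d)
    (f : 'rV[R]_d -> 'rV[R]_d) : Prop :=
  forall x, V x ->
    differentiable f x /\ {for x, continuous (fun y => 'J f y)}.

(* Psi and Phi are total functions; only their restrictions to V and U matter. *)
Definition C1_diffeo (R : realType) (d : nat) (V U : set 'rV[R]_d)
    (Psi : 'rV[R]_d -> 'rV[R]_d) : Prop :=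
  exists Phi : 'rV[R]_d -> 'rV[R]_d,
    [/\ (forall y, V y -> U (Psi y) /\ Phi (Psi y) = y),
        (forall x, U x -> V (Phi x) /\ Psi (Phi x) = x),
        C1_on V Psi & C1_on U Phi].

(* Coordinates are indexed from 0, so y_{m+1}, ..., y_d are the y 0 i, m <= i. *)
Definition C1_submanifold (R : realType) (d m : nat) (M : set 'rV[R]_d) :
    Prop :=
  M !=set0 /\
  forall xi, M xi ->
    exists (U V : set 'rV[R]_d) (Psi : 'rV[R]_d -> 'rV[R]_d),
      [/\ open U, open V, U xi, C1_diffeo V U Psi &
          forall y, V y ->
            (M (Psi y) <-> forall i : 'I_d, (m <= i)%N -> y 0 i = 0)].

(* Velocities at time 0 of C^1 curves in M through xi. *)
Definition tangent_space (R : realType) (d : nat) (M : set 'rV[R]_d)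
    (xi : 'rV[R]_d) : set 'rV[R]_d :=
  [set v : 'rV[R]_d | exists (gamma : R -> 'rV[R]_d) (e : R),
    [/\ 0 < e,
        (forall t, `|t| < e ->
           [/\ M (gamma t), derivable gamma t 1 &
               {for t, continuous (derive1 gamma)}]),
        gamma 0 = xi & derive1 gamma 0 = v]].

(* The real-valued sup and inf have their intended meaning when T1 and T2 are
   linear subspaces of positive dimension: the sets are then nonempty and
   bounded. *)
Definition subspace_dist (R : realType) (d : nat) (T1 T2 : set 'rV[R]_d) : R :=
  sup [set inf [set norm2 (t2 - t1) | t2 in T2 `&` @unit_sphere R d]
      | t1 in T1 `&` @unit_sphere R d].

Definition C11_submanifold (R : realType) (d m : nat) (M : set 'rV[R]_d) :
    Prop :=
  C1_submanifold m M /\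
  forall xi, M xi ->
    exists (W : set 'rV[R]_d) (L : R),
      [/\ open W, W xi, 0 < L &
          forall zeta eta, (M `&` W) zeta -> (M `&` W) eta ->
            subspace_dist (tangent_space M zeta) (tangent_space M eta)
              <= L * norm2 (zeta - eta)].

Definition dist_to (R : realType) (d : nat) (x : 'rV[R]_d)
    (M : set 'rV[R]_d) : R :=
  inf [set norm2 (x - xi) | xi in M].

Definition unpp (R : realType) (d : nat) (M : set 'rV[R]_d) : set 'rV[R]_d :=
  [set x | exists! xi, M xi /\ norm2 (x - xi) = dist_to x M].

Definition unpp_interior (R : realType) (d : nat) (M : set 'rV[R]_d) :
    set 'rV[R]_d :=
  (unpp M)^°.

Definition unit_normal_bundle (R : realType) (d : nat) (M : set 'rV[R]_d) :
    set ('rV[R]_d * 'rV[R]_d) :=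
  [set p | [/\ M p.1,
               (forall t, tangent_space M p.1 t -> dotp p.2 t = 0) &
               norm2 p.2 = 1]].

(* Only meant for p in unit_normal_bundle M; for M of class C^{1,1} the set of
   admissible radii is then nonempty, so that the value lies in ]0, +oo]. *)
Definition frontier_function (R : realType) (d : nat) (M : set 'rV[R]_d)
    (p : 'rV[R]_d * 'rV[R]_d) : \bar R :=
  ereal_sup [set r%:E | r in
    [set r : R | 0 < r /\
       open_segment p.1 (p.1 + r *: p.2) `<=` unpp_interior M]].

Definition maximal_ball (R : realType) (d : nat) (A : set 'rV[R]_d)
    (x : 'rV[R]_d) (r : R) : Prop :=
  ball2 x r `<=` A /\
  forall (x' : 'rV[R]_d) (r' : R), 0 < r' ->
    ball2 x r `<=` ball2 x' r' -> ball2 x' r' `<=` A -> r' = r /\ x' = x.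

Definition skeleton (R : realType) (d : nat) (A : set 'rV[R]_d) :
    set 'rV[R]_d :=
  [set x | exists2 r : R, 0 < r & maximal_ball A x r].

(* Main.v *)
(* Write d for the distance to M and E for the interior of unpp M.
   If x lies in E but not in M, then d has slope 1 at x, and maximizing
   d(y) - r |y - x| over a small closed ball for r tending to 1 gives y <> x with
   d(y) = d(x) + |y - x|.  Hence, as long as the segment from xi in direction v
   stays in E, the ball of radius s about xi + s v misses M.
   Lower semicontinuity of the frontier function follows from compactness of
   segments and from M being contained in the open set E; this is where C^{1,1}
   enters, via |<v, eta - xi>| <= K |v| |eta - xi|^2 for v normal to M at xi.
   For upper semicontinuity, the condition that the ball about xi + s v misses M
   passes to limits of (xi, v), and when it holds for some t > s then xi + s v is
   not in the skeleton.  Since the skeleton is closed, no nearby point is in it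
   either, and a point off the closure of M and off the skeleton has only one
   nearest point in the closure of M; thus xi + s v is in E. *)
Require Import Defs.
From HB Require Import structures.
From mathcomp Require Import all_boot all_order all_algebra.
From mathcomp Require Import all_classical all_reals all_analysis.
From mathcomp Require Import ring lra.

Set Implicit Arguments.
Unset Strict Implicit.
Unset Printing Implicit Defensive.

Import Order.TTheory GRing.Theory Num.Theory.
Import numFieldNormedType.Exports.

Local Open Scope classical_set_scope.
Local Open Scope ring_scope.

(** * Euclidean inner product, norm, balls, and nearest points of closed sets *)

Section Euclid.
Context {R : realType} {d : nat}.
Implicit Types (u v w x y z : 'rV[R]_d) (a b r s t : R).

Lemma dotpC u v : dotp u v = dotp v u.
Proof. by apply: eq_bigr => i _; rewrite mulrC. Qed.

Lemma dotpDl u v w : dotp (u + v) w = dotp u w + dotp v w.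
Proof. by rewrite -big_split; apply: eq_bigr => i _; rewrite mxE mulrDl. Qed.

Lemma dotpDr u v w : dotp w (u + v) = dotp w u + dotp w v.
Proof. by rewrite dotpC dotpDl !(dotpC w). Qed.

Lemma dotpZl a u v : dotp (a *: u) v = a * dotp u v.
Proof. by rewrite mulr_sumr; apply: eq_bigr => i _; rewrite mxE mulrA. Qed.

Lemma dotpZr a u v : dotp u (a *: v) = a * dotp u v.
Proof. by rewrite dotpC dotpZl dotpC. Qed.

Lemma dotpNl u v : dotp (- u) v = - dotp u v.
Proof. by rewrite -scaleN1r dotpZl mulN1r. Qed.

Lemma dotpNr u v : dotp u (- v) = - dotp u v.
Proof. by rewrite dotpC dotpNl dotpC. Qed.

Lemma dotp0l v : dotp 0 v = 0.
Proof. by rewrite -(scale0r 0) dotpZl mul0r. Qed.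

Lemma dotp0r v : dotp v 0 = 0.
Proof. by rewrite dotpC dotp0l. Qed.

Definition dotpE := (dotpDl, dotpDr, dotpNl, dotpNr, dotpZl, dotpZr).

Lemma dotp_ge0 u : 0 <= dotp u u.
Proof. by apply: sumr_ge0 => i _; rewrite -expr2 sqr_ge0. Qed.

Lemma dotp_eq0 u : dotp u u = 0 -> u = 0.
Proof.
move=> /eqP; rewrite psumr_eq0; last by move=> i _; rewrite -expr2 sqr_ge0.
move=> /allP u0; apply/rowP => i; rewrite mxE.
by have := u0 i (mem_index_enum _); rewrite /= -expr2 sqrf_eq0 => /eqP.
Qed.

Lemma norm2_ge0 u : 0 <= norm2 u.
Proof. exact: sqrtr_ge0. Qed.

Lemma sqr_norm2 u : norm2 u ^+ 2 = dotp u u.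
Proof. by rewrite sqr_sqrtr ?dotp_ge0. Qed.

Lemma norm2_eq0 u : norm2 u = 0 -> u = 0.
Proof. by move=> u0; apply: dotp_eq0; rewrite -sqr_norm2 u0 expr0n. Qed.

Lemma norm20 : norm2 (0 : 'rV[R]_d) = 0.
Proof. by rewrite /norm2 dotp0l sqrtr0. Qed.

Lemma norm2_gt0 u : u != 0 -> 0 < norm2 u.
Proof.
by move=> u0; rewrite lt_def norm2_ge0 andbT; apply: contra_neq u0 => /norm2_eq0.
Qed.

Lemma norm2Z a u : norm2 (a *: u) = `|a| * norm2 u.
Proof. by rewrite /norm2 !dotpE mulrA -expr2 sqrtrM ?sqr_ge0// sqrtr_sqr. Qed.

Lemma norm2N u : norm2 (- u) = norm2 u.
Proof. by rewrite -scaleN1r norm2Z normrN1 mul1r. Qed.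

Lemma dist2C u v : norm2 (u - v) = norm2 (v - u).
Proof. by rewrite -norm2N opprB. Qed.

Lemma cauchy_schwarz u v : dotp u v <= norm2 u * norm2 v.
Proof.
have [u0|u0] := eqVneq u 0; first by rewrite u0 norm20 mul0r dotp0l.
have [v0|v0] := eqVneq v 0; first by rewrite v0 norm20 mulr0 dotp0r.
have := dotp_ge0 (norm2 v *: u - norm2 u *: v).
have := norm2_gt0 u0; have := norm2_gt0 v0.
rewrite !dotpE -!sqr_norm2 (dotpC v u).
move: (norm2 u) (norm2 v) (dotp u v) => p q c q0 p0 h.
rewrite -subr_ge0 -(@pmulr_rge0 _ (p * q * 2)) ?mulr_gt0//.
by apply: (le_trans h); rewrite le_eqVlt; apply/orP; left; apply/eqP; ring.
Qed.

Lemma norm2_le_sqr u r : 0 <= r -> (norm2 u <= r) = (dotp u u <= r ^+ 2).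
Proof. by move=> r0; rewrite -sqr_norm2 ler_sqr ?nnegrE ?norm2_ge0. Qed.

Lemma norm2_ge_sqr u r : 0 <= r -> (r <= norm2 u) = (r ^+ 2 <= dotp u u).
Proof. by move=> r0; rewrite -sqr_norm2 ler_sqr ?nnegrE ?norm2_ge0. Qed.

Lemma ler_norm2D u v : norm2 (u + v) <= norm2 u + norm2 v.
Proof.
rewrite norm2_le_sqr ?addr_ge0 ?norm2_ge0// !dotpE (dotpC v u) -!sqr_norm2.
have := cauchy_schwarz u v; nra.
Qed.

Lemma ler_dist2D z x y : norm2 (x - y) <= norm2 (x - z) + norm2 (z - y).
Proof. by rewrite -(subrKA z) ler_norm2D. Qed.

(** Equality case of the triangle inequality: squaring the last hypothesis gives [t <= dotp v w],
    hence |w - t v|^2 = 2 t^2 - 2 t <v, w> <= 0. *)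
Lemma norm2D_eq v w s t :
  norm2 v = 1 -> 0 < s -> norm2 w = t -> s + t <= norm2 (s *: v + w) ->
  w = t *: v.
Proof.
move=> v1 s0 wt; have t0 : 0 <= t by rewrite -wt norm2_ge0.
rewrite norm2_ge_sqr ?addr_ge0 ?(ltW s0)// !dotpE -!sqr_norm2 v1 wt (dotpC w v).
move=> h; apply/subr0_eq/dotp_eq0/le_anti; rewrite dotp_ge0 andbT.
rewrite !dotpE -!sqr_norm2 v1 wt (dotpC w v).
have : t <= dotp v w by rewrite -(ler_pM2l s0); nra.
nra.
Qed.

Lemma coord_le_mx_norm m n (A : 'M[R]_(m, n)) i j : `|A i j| <= `|A|.
Proof.
rewrite [leRHS]/Num.Def.normr/= mx_normrE.
exact: (le_bigmax _ (fun ij : 'I_m * 'I_n => `|A ij.1 ij.2|) (i, j)).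
Qed.

Lemma mx_norm_le_norm2 u : `|u| <= norm2 u.
Proof.
rewrite [leLHS]/Num.Def.normr/= mx_normrE; apply: bigmax_le; rewrite ?norm2_ge0//.
move=> [i j] _ /=; rewrite ord1 -[leLHS]sqrtr_sqr ler_wsqrtr//.
by rewrite /dotp (bigD1 j)//= -expr2 lerDl sumr_ge0// => k _; rewrite -expr2 sqr_ge0.
Qed.

Lemma norm2_le_mx_norm u : norm2 u <= d%:R * `|u|.
Proof.
rewrite norm2_le_sqr ?mulr_ge0//.
have le (i : 'I_d) : u 0 i * u 0 i <= `|u| ^+ 2.
  by rewrite -expr2 -real_normK ?num_real// ler_sqr ?nnegrE// coord_le_mx_norm.
apply: (@le_trans _ _ (\sum_(i < d) `|u| ^+ 2)); first exact: ler_sum.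
rewrite sumr_const card_ord exprMn -[leLHS]mulr_natl ler_wpM2r ?sqr_ge0//.
by rewrite -natrX ler_nat -mulnn; case: (posnP d) => [->//|d0]; rewrite leq_pmull.
Qed.

Lemma nbhs_ball2P x (A : set 'rV[R]_d) :
  nbhs x A <-> exists2 e, 0 < e & ball2 x e `<=` A.
Proof.
split.
  move=> /nbhs_ballP[e /= e0 eA]; exists e => // y /= ye.
  apply: eA; rewrite -ball_normE /=; apply: le_lt_trans (mx_norm_le_norm2 _) _.
  by rewrite dist2C.
(* [norm2] is at most [d] times the sup norm, so this sup-norm ball fits; [d.+1] keeps the divisor
   nonzero when [d = 0]. *)
move=> [e e0 eA]; apply/nbhs_ballP; exists (e / d.+1%:R) => /=.
  by rewrite divr_gt0.
move=> y; rewrite -ball_normE /= ltr_pdivlMr// => ye; apply: eA.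
rewrite /ball2 /=; apply: le_lt_trans (norm2_le_mx_norm _) _.
rewrite -normrN opprB; apply: le_lt_trans ye; rewrite mulrC ler_wpM2l//.
by rewrite ler_nat.
Qed.

Lemma nbhs_ball2 x r : 0 < r -> nbhs x (ball2 x r).
Proof. by move=> r0; apply/nbhs_ball2P; exists r. Qed.

Lemma closure_ball2P (A : set 'rV[R]_d) x :
  closure A x <-> forall e, 0 < e -> exists2 y, A y & norm2 (y - x) < e.
Proof.
split=> [Ax e e0|Ax B /nbhs_ball2P[e e0 eB]].
  by have [y [Ay ye]] := Ax _ (nbhs_ball2 x e0); exists y.
by have [y Ay ye] := Ax _ e0; exists y; split => //; apply: eB.
Qed.

Lemma dist2_continuous y : continuous (fun x => norm2 (x - y)).
Proof.
move=> x; apply/(@cvgrPdist_lt _ _ _ (nbhs x) (nbhs_filter x)) => e e0.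
apply: filterS (nbhs_ball2 x e0) => z; rewrite /ball2 /=.
have := ler_dist2D x z y; have := ler_dist2D z x y.
rewrite (dist2C x z) ltr_norml => *; apply/andP; split; lra.
Qed.

Lemma compact_ball2 (A : set 'rV[R]_d) x r :
  closed A -> A `<=` [set y | norm2 (y - x) <= r] -> compact A.
Proof.
move=> cA Ar; apply: bounded_closed_compact => //.
exists (r + norm2 x); split; first exact: num_real.
move=> M rM y /= /Ar /= yr; apply: le_trans (mx_norm_le_norm2 _) _.
by rewrite -(subrK x y) (le_trans (ler_norm2D _ _))// (le_trans _ (ltW rM))// lerD.
Qed.

Lemma closed_dist2_le x r : closed [set y | norm2 (y - x) <= r].
Proof.
apply: (@preimage_closed _ _ (fun y => norm2 (y - x)) [set t | t <= r]); last exact: closed_le.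
by move=> y _; exact: dist2_continuous.
Qed.

Lemma closed_dist2_ge x r : closed [set y | r <= norm2 (y - x)].
Proof.
apply: (@preimage_closed _ _ (fun y => norm2 (y - x)) [set t | r <= t]); last exact: closed_ge.
by move=> y _; exact: dist2_continuous.
Qed.

Lemma nearest_point (C : set 'rV[R]_d) x : closed C -> C !=set0 ->
  exists2 q, C q & forall z, C z -> norm2 (x - q) <= norm2 (x - z).
Proof.
move=> cC [c Cc]; pose A := C `&` [set y | norm2 (y - x) <= norm2 (c - x)].
have cA : compact A.
  apply: (@compact_ball2 _ x (norm2 (c - x))); last by move=> y [].
  by apply: closedI => //; exact: closed_dist2_le.
have A0 : A !=set0 by exists c; split => /=.
have [|q] := @compact_EVT_min _ _ (fun y => norm2 (y - x)) A A0 cA.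
  by apply: continuous_subspaceT; exact: dist2_continuous.
rewrite inE => -[Cq _] qmin; exists q => // z Cz; rewrite !(dist2C x).
have [zc|cz] := leP (norm2 (z - x)) (norm2 (c - x)).
  by apply: qmin; rewrite inE.
by apply: le_trans (ltW cz); apply: qmin; rewrite inE; split => /=.
Qed.

End Euclid.

(** * The distance to a nonempty set, its nearest points, and the skeleton of the complement *)

Section Distance.
Context {R : realType} {d : nat} (M : set 'rV[R]_d) (M0 : M !=set0).
Implicit Types (u v w x y z p q : 'rV[R]_d) (a b r s t e : R).

Lemma dist_to_le x q : M q -> dist_to x M <= norm2 (x - q).
Proof.
move=> Mq; apply: ge_inf; last by exists q.
by exists 0 => _ [z _ <-]; exact: norm2_ge0.
Qed.

Lemma dist_to_le_closure x q : closure M q -> dist_to x M <= norm2 (x - q).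
Proof.
move=> /closure_ball2P Mq; apply/ler_addgt0Pr => e /Mq [z Mz zq].
apply: le_trans (dist_to_le x Mz) _; have := ler_dist2D q x z.
rewrite (dist2C q z); lra.
Qed.

(** [M] need not be closed, so the minimum is attained in the closure; passing to the closure does
    not change the infimum. *)
Lemma exists_nearest x : exists2 q, closure M q & norm2 (x - q) = dist_to x M.
Proof.
have [|q Cq qmin] := nearest_point x (@closed_closure _ M).
  by have [z Mz] := M0; exists z; exact: subset_closure.
exists q => //; apply/le_anti; rewrite dist_to_le_closure// andbT.
apply: lb_le_inf; first by have [z Mz] := M0; exists (norm2 (x - z)), z.
by move=> _ [z Mz <-]; apply/qmin/subset_closure.
Qed.

Lemma dist_to_lip x y : dist_to x M <= dist_to y M + norm2 (x - y).
Proof.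
have [q Cq <-] := exists_nearest y; apply: le_trans (dist_to_le_closure x Cq) _.
by rewrite [leRHS]addrC ler_dist2D.
Qed.

Lemma dist_to_continuous : continuous (fun x => dist_to x M).
Proof.
move=> x; apply/(@cvgrPdist_lt _ _ _ (nbhs x) (nbhs_filter x)) => e e0.
apply: filterS (nbhs_ball2 x e0) => z; rewrite /ball2 /=.
have := dist_to_lip x z; have := dist_to_lip z x.
rewrite (dist2C x z) ltr_norml => *; apply/andP; split; lra.
Qed.

Lemma ball2_setC x r : ball2 x r `<=` ~` M <-> r <= dist_to x M.
Proof.
split=> [rM|rx z + Mz].
  apply: lb_le_inf; first by have [z Mz] := M0; exists (norm2 (x - z)), z.
  by move=> _ [z Mz <-]; rewrite leNgt dist2C; apply/negP => /rM.
by rewrite /ball2 /= dist2C ltNge (le_trans rx (dist_to_le x Mz)).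
Qed.

(* Were q not in M, then M would have no nearest point to points slightly closer
   to q than x. *)
Lemma unpp_interior_nearest x q :
  unpp_interior M x -> closure M q -> norm2 (x - q) = dist_to x M -> M q.
Proof.
move=> Ex Cq; set D := dist_to x M => qD.
have [q0|D0] := eqVneq D 0.
  have [p [[Mp pD] _]] := interior_subset Ex.
  suff -> : q = p by [].
  move: qD pD; rewrite -/D q0 => /norm2_eq0/subr0_eq <- /norm2_eq0/subr0_eq.
  by [].
have {}D0 : 0 < D by rewrite lt_def D0 -qD norm2_ge0.
have [e e0 eE] := (nbhs_ball2P _ _).1 Ex.
pose v := D^-1 *: (x - q).
have v1 : norm2 v = 1 by rewrite norm2Z qD gtr0_norm ?invr_gt0// mulVf// gt_eqF.
have xq : x - q = D *: v by rewrite scalerA divff ?gt_eqF// scale1r.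
pose s := Num.min (e / 2) (D / 2).
have s0 : 0 < s by rewrite lt_min !divr_gt0.
have se : s < e by rewrite gt_min ltr_pdivrMr// ltr_pMr// ltr1n.
have sD : s < D by rewrite gt_min (ltr_pdivrMr _ D)// ltr_pMr// ltr1n orbT.
have [p [[Mp pD] _]] : unpp M (x - s *: v).
  apply: eE; rewrite /ball2 /= addrAC subrr sub0r norm2N norm2Z v1 mulr1.
  by rewrite gtr0_norm.
have le : dist_to (x - s *: v) M <= D - s.
  apply: le_trans (dist_to_le_closure _ Cq) _.
  have -> : x - s *: v - q = (D - s) *: v by rewrite addrAC xq scalerBl.
  by rewrite norm2Z v1 mulr1 gtr0_norm// subr_gt0.
have xp : x - p = s *: v + (x - s *: v - p).
  by rewrite addrA [s *: v + _]addrC subrK.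
(* Here |x - p| >= D while p is within D - s of x - s v: the triangle inequality is an equality, so
   x - p = D v = x - q. *)
have Dp : D <= norm2 (x - p) by exact: dist_to_le.
have := norm2D_eq v1 s0 pD; rewrite -xp => /(_ _) wv.
have {}wv := wv ltac:(lra).
have Ds : dist_to (x - s *: v) M = D - s.
  apply/le_anti; rewrite le/=; move: Dp; rewrite xp wv -scalerDl norm2Z v1 mulr1.
  by rewrite ger0_norm ?addr_ge0 ?(ltW s0) -?pD ?norm2_ge0// => h; lra.
have : x - p = x - q by rewrite xp wv Ds -scalerDl xq; congr (_ *: _); lra.
by move=> /addrI/oppr_inj <-.
Qed.

(** Competitors range over the closure of [M], since compactness arguments only yield nearest points
    there. *)
Definition unique_nearest x p :=
  [/\ closure M p, norm2 (x - p) = dist_to x M &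
      forall q, closure M q -> norm2 (x - q) = dist_to x M -> q = p].

Lemma unpp_interior_unique x :
  unpp_interior M x -> exists p, unique_nearest x p.
Proof.
move=> Ex; have [p [[Mp pD] pu]] := interior_subset Ex.
exists p; split => //; first exact: subset_closure.
by move=> q Cq qD; apply/esym/pu; split => //; exact: unpp_interior_nearest Cq qD.
Qed.

(** Continuity of the nearest-point map at [x]: points of the closure at distance at least [e] from
    [p] are farther from [x] than [dist_to x M] by a positive gap, attained at some [q']. *)
Lemma nearest_near x p e : unique_nearest x p -> 0 < e ->
  exists2 a, 0 < a & forall z q, norm2 (z - x) < a -> closure M q ->
    norm2 (z - q) = dist_to z M -> norm2 (q - p) < e.
Proof.
move=> [Cp pD pu] e0.
pose A := closure M `&` [set y | e <= norm2 (y - p)].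
have cA : closed A.
  by apply: closedI; [exact: closed_closure|exact: closed_dist2_ge].
have [A0|/set0P/negP/negPn/eqP A0] := pselect (A !=set0); last first.
  exists 1 => // z q _ Cq _; rewrite ltNge; apply/negP => eq.
  by have : A q by []; rewrite A0.
have [q' [Cq' eq'] q'min] := nearest_point x cA A0.
have Dq' : dist_to x M < norm2 (x - q').
  rewrite lt_neqAle dist_to_le_closure// andbT; apply/eqP => /esym/(pu _ Cq') q'p.
  by move: eq'; rewrite /= q'p subrr norm20 leNgt e0.
(* Half the gap, because passing from [z] to [x] costs |z - x| twice: once in the distance to [q]
   and once in [dist_to]. *)
exists ((norm2 (x - q') - dist_to x M) / 2); first by rewrite divr_gt0// subr_gt0.
move=> z q zx Cq qD; rewrite ltNge; apply/negP => eq.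
have := q'min q (conj Cq eq); have := ler_dist2D z x q; have := dist_to_lip z x.
rewrite (dist2C x z); lra.
Qed.

(** Step from x by h in the unit direction n away from p. A nearest point q of the new point is
    within (1 - r) D of p, so <x - q, n> > r D, and expanding |x - q + h n|^2 gives more than (D + r
    h)^2. *)
Lemma dist_to_slope x p e r : unique_nearest x p -> 0 < dist_to x M ->
  0 <= r < 1 -> 0 < e ->
  exists2 z, norm2 (z - x) < e & dist_to x M + r * norm2 (z - x) < dist_to z M.
Proof.
move=> xp D0 /andP[r0 r1] e0; set D := dist_to x M in D0 *.
have [Cp pD pu] := xp.
have rD : 0 < (1 - r) * D by rewrite mulr_gt0// subr_gt0.
have [a a0 near] := nearest_near xp rD.
pose h := Num.min (a / 2) (e / 2).
have h0 : 0 < h by rewrite lt_min !divr_gt0.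
have ha : h < a by rewrite gt_min ltr_pdivrMr// ltr_pMr// ltr1n.
have he : h < e by rewrite gt_min (ltr_pdivrMr _ e)// ltr_pMr// ltr1n orbT.
pose n := D^-1 *: (x - p).
have n1 : norm2 n = 1 by rewrite norm2Z pD gtr0_norm ?invr_gt0// mulVf// gt_eqF.
have xpn : x - p = D *: n by rewrite scalerA divff ?gt_eqF// scale1r.
clearbody n; have zx : norm2 (x + h *: n - x) = h.
  by rewrite addrAC subrr add0r norm2Z n1 mulr1 gtr0_norm.
exists (x + h *: n); rewrite zx//.
have [q Cq qD] := exists_nearest (x + h *: n).
have := near _ _ _ Cq qD; rewrite zx => /(_ ha) qp.
have Drh : 0 <= D + r * h by rewrite addr_ge0 ?mulr_ge0// ltW.
rewrite -qD ltNge norm2_le_sqr// -ltNge.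
have Dq : D <= norm2 (x - q) by exact: dist_to_le_closure.
have -> : x + h *: n - q = (x - q) + h *: n by rewrite addrAC.
have exp w : dotp (w + h *: n) (w + h *: n) = norm2 w ^+ 2 + 2 * h * dotp w n + h ^+ 2.
  by rewrite !dotpE (dotpC n) -!sqr_norm2 n1; ring.
rewrite exp; have : dotp (x - q) n = D + dotp (p - q) n.
  rewrite -(subrKA p x) xpn (dotpDl (D *: n)) dotpZl -sqr_norm2 n1.
  by rewrite expr1n mulr1.
have := cauchy_schwarz (q - p) n; rewrite n1 mulr1 -(opprB p q) norm2N dotpNl.
move: qp; rewrite dist2C.
move: (dotp (p - q) n) (dotp (x - q) n) (norm2 _) (norm2 _) Dq => k l j i Dq jr kj ->.
clear -r0 r1 h0 D0 Dq jr kj; clearbody h D.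
have : h * (- k) < h * ((1 - r) * D) by rewrite ltr_pM2l//; lra.
have : D ^+ 2 <= i ^+ 2 by rewrite ler_sqr ?nnegrE; lra.
have : (r * h) ^+ 2 < h ^+ 2 by rewrite exprMn gtr_pMl ?exprn_gt0// expr_lt1.
nra.
Qed.

(* For r < 1, the maximum of dist_to y M - r |y - x| over a small closed ball lies
   on its boundary, because dist_to _ M has slope 1; then let r tend to 1. *)
Lemma dist_to_climb x : unpp_interior M x -> 0 < dist_to x M ->
  exists2 y, 0 < norm2 (y - x) & dist_to x M + norm2 (y - x) <= dist_to y M.
Proof.
move=> Ex D0; have [e e0 eE] := (nbhs_ball2P _ _).1 (@open_interior _ (unpp M) _ Ex).
set D := dist_to x M in D0 *.
(* [T < e] keeps the closed ball in the interior of [unpp M]; [T < D] keeps the distance to [M]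
   positive on it. *)
pose T := Num.min (e / 2) (D / 2).
have T0 : 0 < T by rewrite lt_min !divr_gt0.
have Te : T < e by rewrite gt_min ltr_pdivrMr// ltr_pMr// ltr1n.
have TD : T < D by rewrite gt_min (ltr_pdivrMr _ D)// ltr_pMr// ltr1n orbT.
pose B := [set y | norm2 (y - x) <= T].
have cB : compact B by exact: (compact_ball2 (@closed_dist2_le _ _ x T) (fun _ h => h)).
have B0 : B !=set0 by exists x; rewrite /B /= subrr norm20 ltW.
have sphere r : 0 <= r < 1 ->
    exists2 y, norm2 (y - x) = T & D + r * T <= dist_to y M.
  move=> r01.
  have [|c] := @compact_EVT_max _ _ (fun y => dist_to y M - r * norm2 (y - x)) B B0 cB.
    apply: continuous_subspaceT => y.
    apply: (@continuousB _ _ _ (fun y => dist_to y M) (fun y => r * norm2 (y - x))).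
      exact: dist_to_continuous.
    apply: (@continuousM _ _ (fun=> r)); first exact: cst_continuous.
    exact: dist2_continuous.
  rewrite inE => cT cmax; have xB : x \in B by rewrite inE /B /= subrr norm20 ltW.
  have {xB} := cmax _ xB; rewrite subrr norm20 mulr0 subr0 -/D => Dc.
  have [cx|cx] := ltP (norm2 (c - x)) T; last first.
    have cT' : norm2 (c - x) = T by apply/le_anti; rewrite cT cx.
    by exists c => //; move: Dc; rewrite cT'; lra.
  (* A maximizer [c] inside the ball is impossible: [dist_to_slope] at [c] yields a point of the
     ball with a larger value. *)
  have [|p cp] := @unpp_interior_unique c; first by apply: eE; exact: lt_trans Te.
  have [||z zc zD] := @dist_to_slope c p (T - norm2 (c - x)) r cp _ r01.
  - by have := dist_to_lip x c; rewrite -/D dist2C; lra.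
  - by rewrite subr_gt0.
  have := ler_dist2D c z x => tri.
  have := cmax z; rewrite inE => /(_ _) h; have {}h := h ltac:(rewrite /B /=; lra).
  case/andP: r01 => r0 r1; have : r * norm2 (z - x) <= r * (norm2 (z - c) + norm2 (c - x)).
    by rewrite ler_wpM2l.
  lra.
(* A maximizer of the distance on this sphere does not depend on [r], so it satisfies the bounds for
   all [r < 1] at once. *)
pose S := [set y | norm2 (y - x) <= T] `&` [set y | T <= norm2 (y - x)].
have cS : compact S.
  apply: (@compact_ball2 _ _ S x T); last by move=> y [].
  by apply: closedI; [exact: closed_dist2_le|exact: closed_dist2_ge].
have S0 : S !=set0.
  have [|y yT _] := sphere 0; first by rewrite lexx ltr01.
  by exists y; rewrite /S /= yT.
have [|y] := @compact_EVT_max _ _ (fun y => dist_to y M) S S0 cS.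
  by apply: continuous_subspaceT => y; exact: dist_to_continuous.
rewrite inE => -[/= y1 y2] ymax.
have yT : norm2 (y - x) = T by apply/le_anti; rewrite y1 y2.
exists y; rewrite yT// leNgt; apply/negP => yD.
have le r : 0 <= r < 1 -> D + r * T <= dist_to y M.
  move=> /sphere [z zT]; move=> /le_trans; apply; apply: ymax.
  by rewrite inE /S /= zT.
have := le 0; rewrite lexx ltr01 mul0r addr0 => /(_ isT) Dy.
(* [k] is the slope reached at [y]; if it were below 1, the bound for r = (1 + k) / 2 would fail. *)
pose k := (dist_to y M - D) / T.
have kT : k * T = dist_to y M - D by rewrite /k divfK// gt_eqF.
have k0 : 0 <= k by rewrite divr_ge0 ?subr_ge0// ltW.
have k1 : k < 1 by rewrite ltr_pdivrMr// mul1r; lra.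
have := le ((1 + k) / 2) => /(_ _) h; have {}h := h ltac:(apply/andP; split; lra).
nra.
Qed.

(** If the claim fails at s, the a with d(x + a v) >= a are bounded by s and have a largest element
    b > 0. As x + b v is still in the interior of [unpp M], [dist_to_climb] applies there and pushes
    b further. *)
Lemma dist_to_segment x v r t : M x -> norm2 v = 1 -> 0 < t ->
  t <= dist_to (x + t *: v) M ->
  open_segment x (x + r *: v) `<=` unpp_interior M ->
  forall s, 0 < s < r -> s <= dist_to (x + s *: v) M.
Proof.
move=> Mx v1 t0 tA rE s /andP[s0 sr]; rewrite leNgt; apply/negP => sA.
pose A := [set a | a <= dist_to (x + a *: v) M].
have lip a b : a <= b -> dist_to (x + b *: v) M <= dist_to (x + a *: v) M + (b - a).
  move=> ab; apply: le_trans (dist_to_lip _ (x + a *: v)) _; rewrite lerD2l.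
  have -> : x + b *: v - (x + a *: v) = (b - a) *: v.
    by rewrite opprD addrACA subrr add0r scalerBl.
  by rewrite norm2Z v1 mulr1 ger0_norm// subr_ge0.
have As a : A a -> a <= s.
  move=> Aa; rewrite leNgt; apply/negP => sa; move: sA; apply/negP; rewrite -leNgt.
  by have := lip _ _ (ltW sa); rewrite /A /= in Aa; lra.
have hA : has_sup A by split; [exists t|exists s => a /As].
have ts : t <= sup A by apply: sup_upper_bound.
have sups : sup A <= s by apply: ge_sup; [exists t|move=> a /As].
have Asup : A (sup A).
  rewrite /A /= leNgt; apply/negP => h.
  have [|a Aa la] := @sup_adherent _ A ((sup A - dist_to (x + sup A *: v) M) / 2) _ hA.
    by rewrite divr_gt0// subr_gt0.
  have := lip _ _ (sup_upper_bound hA Aa).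
  have := dist_to_lip (x + a *: v) (x + sup A *: v).
  have -> : x + a *: v - (x + sup A *: v) = (a - sup A) *: v.
    by rewrite opprD addrACA subrr add0r scalerBl.
  rewrite norm2Z v1 mulr1 ler0_norm ?subr_le0 ?(sup_upper_bound hA)//.
  by rewrite /A /= in Aa; lra.
set b := sup A in ts sups Asup *.
have b0 : 0 < b by exact: lt_le_trans ts.
have bD : dist_to (x + b *: v) M = b.
  apply/le_anti; rewrite Asup andbT; apply: le_trans (dist_to_le _ Mx) _.
  by rewrite addrAC subrr add0r norm2Z v1 mulr1 gtr0_norm.
have r0 : 0 < r := lt_trans s0 sr.
have [||y] := @dist_to_climb (x + b *: v).
- apply: rE; exists (b / r) => /=.
    by rewrite divr_gt0//= ltr_pdivrMr// mul1r (le_lt_trans sups).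
  by rewrite scalerDr addrA -scalerDl subrK scale1r scalerA divfK// gt_eqF.
- by rewrite bD.
rewrite bD; set T := norm2 _ => T0 yD.
(* The point [x] of [M] is at distance at least b + T from [y], which forces the climb to continue
   along [v]. *)
have eq : y - (x + b *: v) = T *: v.
  apply: (norm2D_eq v1 b0) => //; apply: le_trans yD _.
  have -> : b *: v + (y - (x + b *: v)) = y - x by rewrite opprD addrC addrA subrK.
  exact: dist_to_le.
have : A (b + T).
  rewrite /A /=; suff -> : x + (b + T) *: v = y by [].
  by rewrite scalerDl -eq addrA subrKC.
by move=> /(sup_upper_bound hA); rewrite -/b; lra.
Qed.

(** The ball about y with radius r = d(y, M) is not maximal, so it sits in a different ball missing
    M. A nearest point lies on the boundary of both, and two such nested balls touch in at most one
    point. *)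
Lemma unique_nearest_off_skeleton y q q' :
  0 < dist_to y M -> ~ skeleton (~` M) y ->
  closure M q -> norm2 (y - q) = dist_to y M ->
  closure M q' -> norm2 (y - q') = dist_to y M -> q = q'.
Proof.
set r := dist_to y M => r0 yS Cq qr Cq' q'r.
have [x' [r' [r'0 sub r'M ne]]] : exists x' r', [/\ 0 < r',
    ball2 y r `<=` ball2 x' r', ball2 x' r' `<=` ~` M & ~ (r' = r /\ x' = y)].
  apply: contrapT => h; apply: yS; exists r => //; split; first exact/ball2_setC.
  move=> x' r' r'0 sub r'M; apply: contrapT => ne; apply: h.
  by exists x', r'.
have far p : closure M p -> r' <= norm2 (p - x').
  move=> Cp; rewrite dist2C; apply: le_trans (dist_to_le_closure _ Cp).
  exact/ball2_setC.
(* Inclusion of the open balls extends to the closed ones: move [z] towards [y] by a small factor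
   [k]. *)
have sub' z : norm2 (z - y) <= r -> norm2 (z - x') <= r'.
  move=> zr; apply/ler_addgt0Pr => e e0.
  pose k := Num.min (e / (2 * r)) 1.
  have k0 : 0 < k by rewrite lt_min divr_gt0 ?mulr_gt0//=.
  have k1 : k <= 1 by rewrite ge_min lexx orbT.
  have kr : k * r <= e / 2.
    have : k <= e / (2 * r) by rewrite ge_min lexx.
    by rewrite -(ler_pM2r r0) => /le_trans; apply; rewrite invfM mulrA divfK// gt_eqF.
  have : norm2 (z - k *: (z - y) - x') < r'.
    apply: sub; rewrite /ball2 /=.
    have -> : z - k *: (z - y) - y = (1 - k) *: (z - y).
      by rewrite addrAC scalerBl scale1r.
    rewrite norm2Z ger0_norm ?subr_ge0//.
    apply: (@le_lt_trans _ _ ((1 - k) * r)); first by rewrite ler_wpM2l ?subr_ge0.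
    by rewrite mulrBl mul1r ltrBlDr ltrDl mulr_gt0.
  have := ler_dist2D (z - k *: (z - y)) z x'.
  have -> : z - (z - k *: (z - y)) = k *: (z - y) by rewrite subKr.
  rewrite norm2Z (gtr0_norm k0).
  have : k * norm2 (z - y) <= k * r by rewrite ler_wpM2l// ltW.
  lra.
have [yx'|yx'] := eqVneq y x'.
  exfalso; apply: ne; split => //; apply/le_anti/andP; split.
    by rewrite (le_trans (far _ Cq))// -yx' dist2C qr.
  apply/ler_addgt0Pr => e e0.
  have := sub' q; rewrite dist2C qr lexx => /(_ isT).
  by rewrite -yx' dist2C qr; lra.
pose c := norm2 (y - x'); have c0 : 0 < c by apply: norm2_gt0; rewrite subr_eq0.
pose u := c^-1 *: (y - x').
have u1 : norm2 u = 1 by rewrite norm2Z gtr0_norm ?invr_gt0// mulVf// gt_eqF.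
have yu : y - x' = c *: u by rewrite scalerA divff ?gt_eqF// scale1r.
(* Apply the closed inclusion to y + r u, the point of the smaller ball farthest from x'. *)
clearbody u; have cr : c + r <= r'.
  have := sub' (y + r *: u).
  have -> : y + r *: u - x' = (c + r) *: u by rewrite addrAC yu scalerDl.
  rewrite addrAC subrr add0r !norm2Z u1 !mulr1 !gtr0_norm ?addr_gt0// lexx.
  exact.
have dir p : closure M p -> norm2 (y - p) = r -> p - y = r *: u.
  move=> Cp pr; apply: (norm2D_eq u1 c0); first by rewrite dist2C.
  by rewrite -yu [_ + (p - y)]addrC subrKA (le_trans cr)// far.
by apply: (@addIr _ (- y)); rewrite !dir.
Qed.

(** The ball about x + s v touching x lies in the larger ball about x + t v, so x + s v is off the
    skeleton, and so are nearby points by closedness. Their nearest points in the closure are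
    unique, and lie in M because they are close to x. *)
Lemma unpp_interior_off_skeleton x v e s t :
  closed (skeleton (~` M)) -> M x -> norm2 v = 1 ->
  0 < e -> closure M `&` ball2 x e `<=` M ->
  0 < s < t -> t <= dist_to (x + t *: v) M ->
  unpp_interior M (x + s *: v).
Proof.
move=> cS Mx v1 e0 eM /andP[s0 st] tD; have t0 : 0 < t by exact: lt_trans st.
have step a b : x + b *: v - (x + a *: v) = (b - a) *: v.
  by rewrite opprD addrACA subrr add0r scalerBl.
have sS : ~ skeleton (~` M) (x + s *: v).
  move=> [r r0 [rM rmax]].
  have rs : r <= s.
    rewrite leNgt; apply/negP => sr; apply: (rM x _ Mx).
    by rewrite /ball2 /= opprD addrA subrr sub0r norm2N norm2Z v1 mulr1 gtr0_norm.
  have [||tr _] := rmax (x + t *: v) t t0; last by move: st; rewrite tr; lra.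
    move=> z; rewrite /ball2 /= => zr; have := ler_dist2D (x + s *: v) z (x + t *: v).
    by rewrite step norm2Z v1 mulr1 ltr0_norm ?subr_lt0//; lra.
  exact/ball2_setC.
have sD : dist_to (x + s *: v) M = s.
  apply/le_anti; apply/andP; split.
    apply: le_trans (dist_to_le _ Mx) _.
    by rewrite addrAC subrr add0r norm2Z v1 mulr1 gtr0_norm.
  have := dist_to_lip (x + t *: v) (x + s *: v).
  by rewrite step norm2Z v1 mulr1 gtr0_norm ?subr_gt0//; lra.
have [a a0 aS] : exists2 a, 0 < a & ball2 (x + s *: v) a `<=` ~` skeleton (~` M).
  by apply/nbhs_ball2P; apply: open_nbhs_nbhs; split => //; exact: closed_openC.
pose k := (1 - s / t) * e ^+ 2.
have k0 : 0 < k by rewrite mulr_gt0 ?exprn_gt0// subr_gt0 ltr_pdivrMr// mul1r.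
(* [a] avoids the skeleton, [s / 2] keeps the distance to [M] positive, and the last term gives (s +
   2 b)^2 < s^2 + k. *)
pose b := Num.min a (Num.min (s / 2) (k / (16 * s))).
have b0 : 0 < b by rewrite !lt_min a0 !divr_gt0//= mulr_gt0.
have ba : b <= a by rewrite ge_min lexx.
have bs : b <= s / 2 by rewrite !ge_min lexx !orbT.
have bk : b * (16 * s) <= k.
  by rewrite -ler_pdivlMr ?mulr_gt0// !ge_min lexx !orbT.
(* Since q is outside the t-ball, 2 t <q - x, v> <= |q - x|^2; scaled by s / t, this bounds the
   distance to x + s v below in terms of |q - x|. *)
have quad q : closure M q ->
    s ^+ 2 + (1 - s / t) * norm2 (q - x) ^+ 2 <= norm2 (q - (x + s *: v)) ^+ 2.
  move=> Cq; have : t <= norm2 (q - (x + t *: v)).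
    by rewrite dist2C; apply: le_trans (dist_to_le_closure _ Cq).
  rewrite norm2_ge_sqr ?(ltW t0)// !opprD !addrA !sqr_norm2 (dotpDl _ (- (t *: v))).
  move: (q - x) => w; rewrite !dotpE -!sqr_norm2 v1 (dotpC v w) => h.
  have h2 : 2 * t * dotp w v <= norm2 w ^+ 2 by move: h; nra.
  have : 2 * s * dotp w v <= s / t * norm2 w ^+ 2.
    by rewrite [leRHS]mulrAC ler_pdivlMr//; have := ler_wpM2l (ltW s0) h2; lra.
  nra.
apply/nbhs_ball2P; exists b => // y yb; rewrite /ball2 /= in yb.
have [q Cq qD] := exists_nearest y.
have Mq : M q.
  apply: eM; split => //; rewrite /ball2 /=.
  have := dist_to_lip y (x + s *: v); rewrite -qD sD => qy.
  have := ler_dist2D y q (x + s *: v); rewrite (dist2C q y) => qx.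
  have lt2 : norm2 (q - (x + s *: v)) < s + 2 * b by lra.
  have := quad q Cq => h.
  have h3 : norm2 (q - (x + s *: v)) ^+ 2 < (s + 2 * b) ^+ 2.
    by rewrite ltr_sqr ?nnegrE ?norm2_ge0//; lra.
  have h4 : (1 - s / t) * norm2 (q - x) ^+ 2 < (1 - s / t) * e ^+ 2.
    by rewrite -/k; nra.
  move: h4; rewrite ltr_pM2l; last by rewrite subr_gt0 ltr_pdivrMr// mul1r.
  by rewrite ltr_sqr ?nnegrE ?norm2_ge0// ltW.
exists q; split => // z [Mz zD]; apply: (@unique_nearest_off_skeleton y) => //.
- by have := dist_to_lip (x + s *: v) y; rewrite sD dist2C; lra.
- by apply: aS; exact: lt_le_trans ba.
- exact: subset_closure.
Qed.

End Distance.

(** * Derivatives along lines and local Lipschitz bounds for C^1 maps *)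

Section Calculus.
Context {R : realType} {d : nat}.
Implicit Types (u v w x y z : 'rV[R]_d) (f g : R -> 'rV[R]_d) (F : 'rV[R]_d -> 'rV[R]_d).

Lemma is_derive_coord f (t : R) df (i : 'I_d) :
  is_derive t 1 f df -> is_derive t 1 (fun s => f s 0 i) (df 0 i).
Proof.
move=> [fd fdf]; split; first by have /derivable_mxP/(_ 0 i) := fd.
by rewrite -fdf derive_mx// mxE.
Qed.

Lemma is_derive_dotp f g (t : R) df dg :
  is_derive t 1 f df -> is_derive t 1 g dg ->
  is_derive t 1 (fun s => dotp (f s) (g s)) (dotp df (g t) + dotp (f t) dg).
Proof.
move=> fd gd.
have -> : (fun s => dotp (f s) (g s)) =
    \sum_(i < d) ((fun s => f s 0 i) * (fun s => g s 0 i)).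
  by apply/funext => s; rewrite fct_sumE.
have -> : dotp df (g t) + dotp (f t) dg =
    \sum_(i < d) (f t 0 i *: dg 0 i + g t 0 i *: df 0 i).
  rewrite -big_split/=; apply: eq_bigr => i _.
  by rewrite addrC [df _ _ * _]mulrC.
by apply: is_derive_sum => i; apply: is_deriveM; exact: is_derive_coord.
Qed.

(** Pairing with a fixed [u] reduces a vector-valued curve to the scalar mean value theorem; the
    point [c] depends on [u]. *)
Lemma mean_value_dotp u f (df : R -> 'rV[R]_d) :
  (forall t : R, 0 <= t <= 1 -> is_derive t 1 f (df t)) ->
  exists2 c : R, 0 <= c <= 1 & dotp u (f 1 - f 0) = dotp u (df c).
Proof.
move=> fd; have hd (t : R) : 0 <= t <= 1 ->
    is_derive t 1 (fun s => dotp u (f s)) (dotp u (df t)).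
  move=> /fd ft; have := is_derive_dotp (is_derive_cst u t 1) ft.
  by rewrite dotp0l add0r.
have [|t||c] := @MVT_segment _ (fun s => dotp u (f s)) (fun t => dotp u (df t)) 0 1.
- exact: ler01.
- by rewrite in_itv/= => /andP[t0 t1]; apply: hd; rewrite !ltW.
- apply: derivable_within_continuous => t; rewrite in_itv/= => t01.
  by have [] := hd t t01.
rewrite in_itv/= subr0 => c01 uE.
by exists c => //; rewrite dotpDr dotpNr uE mulr1.
Qed.

Lemma is_derive_line F x w (t : R) : differentiable F (x + t *: w) ->
  is_derive t 1 (fun s => F (x + s *: w)) (w *m 'J F (x + t *: w)).
Proof.
move=> Fd; rewrite -deriveEjacobian//.
have E : (fun h : R => h^-1 *: (((fun s => F (x + s *: w)) \o shift t) (h *: 1)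
                 - F (x + t *: w))) =
    (fun h => h^-1 *: ((F \o shift (x + t *: w)) (h *: w) - F (x + t *: w))).
  apply/funext => h; congr (_ *: (F _ - _)).
  by rewrite /= scalerDl addrCA [h *: 1]mulr1.
by split; [rewrite /derivable E; exact: diff_derivable|rewrite /derive E].
Qed.

Lemma norm2_mulmx w (A : 'M[R]_d) : norm2 (w *m A) <= d%:R ^+ 2 * `|A| * norm2 w.
Proof.
apply: le_trans (norm2_le_mx_norm _) _.
rewrite expr2 -!mulrA ler_wpM2l// [leLHS]/Num.Def.normr/= mx_normrE.
apply: bigmax_le; first by rewrite !mulr_ge0 ?norm2_ge0.
move=> [i j] _ /=; rewrite mxE (le_trans (ler_norm_sum _ _ _))//.
have le k : `|w i k * A k j| <= `|A| * norm2 w.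
  rewrite normrM mulrC ler_pM ?coord_le_mx_norm//.
  exact: le_trans (coord_le_mx_norm _ _ _) (mx_norm_le_norm2 _).
apply: (@le_trans _ _ (\sum_(k < d) `|A| * norm2 w)); first exact: ler_sum.
by rewrite sumr_const card_ord -[leLHS]mulr_natl.
Qed.

Lemma C1_on_near V F x (e : R) : C1_on V F -> V x -> 0 < e ->
  exists2 a, 0 < a & forall y, norm2 (y - x) < a -> `|'J F y - 'J F x| < e.
Proof.
move=> FC1 Vx e0; have [_ Jx] := FC1 x Vx.
have /nbhs_ball2P[a a0 aF] := Jx (ball ('J F x) e) (nbhsx_ballx _ _ e0).
exists a => // y /aF yb; rewrite distrC; move: yb.
by rewrite /preimage /mkset -ball_normE.
Qed.

Lemma C1_on_bound V F x : open V -> C1_on V F -> V x ->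
  exists a K : R, [/\ 0 < a, 0 < K, ball2 x a `<=` V &
    forall y w, ball2 x a y -> norm2 (w *m 'J F y) <= K * norm2 w].
Proof.
move=> oV FC1 Vx.
have [b b0 bV] := (nbhs_ball2P _ _).1 (open_nbhs_nbhs (conj oV Vx)).
have [c c0 cF] := C1_on_near FC1 Vx ltr01.
pose K := d%:R ^+ 2 * (`|'J F x| + 1) + 1.
have K0 : 0 <= d%:R ^+ 2 * (`|'J F x| + 1) by rewrite mulr_ge0 ?sqr_ge0 ?addr_ge0.
exists (Num.min b c), K; split.
- by rewrite lt_min b0 c0.
- by rewrite /K ltr_wpDl.
- by move=> y; rewrite /ball2 /= lt_min => /andP[yb _]; exact: bV.
move=> y w; rewrite /ball2 /= lt_min => /andP[_ yc].
apply: le_trans (norm2_mulmx _ _) _; rewrite ler_wpM2r ?norm2_ge0//.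
rewrite /K ler_wpDr// ler_wpM2l ?sqr_ge0//.
move: ('J F y) ('J F x) (cF _ yc) => A B AB.
by have := ler_normD (A - B) B; rewrite subrK; lra.
Qed.

Lemma ball2_segment x (r : R) y z (t : R) : ball2 x r y -> ball2 x r z ->
  0 <= t <= 1 -> ball2 x r (y + t *: (z - y)).
Proof.
rewrite /ball2 /= => yr zr /andP[t0 t1].
have -> : y + t *: (z - y) - x = (1 - t) *: (y - x) + t *: (z - x).
  by apply/rowP => i; rewrite !mxE; ring.
apply: le_lt_trans (ler_norm2D _ _) _; rewrite !norm2Z !ger0_norm ?subr_ge0//.
set p := norm2 _ in yr *; set q := norm2 _ in zr *.
apply: (@le_lt_trans _ _ (Num.max p q)); last by rewrite gt_max yr zr.
have : p <= Num.max p q by rewrite le_max lexx.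
have : q <= Num.max p q by rewrite le_max lexx orbT.
nra.
Qed.

Lemma C1_on_lip V F x a K : C1_on V F -> ball2 x a `<=` V ->
  (forall y w, ball2 x a y -> norm2 (w *m 'J F y) <= K * norm2 w) ->
  forall y z, ball2 x a y -> ball2 x a z -> norm2 (F z - F y) <= K * norm2 (z - y).
Proof.
(* Testing against the increment [u] itself gives |u|^2 <= |u| K |z - y|, with no loss in the
   constant. *)
move=> FC1 aV FK y z ya za; set u := F z - F y.
have [t t01|c c01] := @mean_value_dotp u (fun t => F (y + t *: (z - y)))
    (fun t => (z - y) *m 'J F (y + t *: (z - y))).
  by apply: is_derive_line; apply: (FC1 _ (aV _ (ball2_segment ya za t01))).1.
rewrite scale1r scale0r addr0 subrKC -/u -sqr_norm2 => uE.
have := FK _ (z - y) (ball2_segment ya za c01).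
have := cauchy_schwarz u ((z - y) *m 'J F (y + c *: (z - y))); rewrite -uE.
have [->|u0] := eqVneq u 0.
  by rewrite norm20 => _; apply: le_trans; exact: norm2_ge0.
by rewrite expr2 ler_pM2l ?norm2_gt0//; exact: le_trans.
Qed.

End Calculus.

(** * Tangent and normal vectors of submanifolds, and the consequences of C^{1,1} regularity *)

Section Submanifold.
Context {R : realType} {d : nat} (M : set 'rV[R]_d).
Implicit Types (u v w x y z : 'rV[R]_d) (a b r s t e : R).

(** Along a curve in [M] through [q], the squared distance to [x] is minimal at time 0, so its
    derivative vanishes there. *)
Lemma nearest_normal x q : M q -> norm2 (x - q) = dist_to x M ->
  forall v, tangent_space M q v -> dotp (x - q) v = 0.
Proof.
move=> Mq qD w [g [e [e0 gM g0 gw]]].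
have gd (t : R) : `|t| < e -> is_derive t 1 g (derive1 g t).
  by move=> /gM[_ gt _]; split => //; rewrite derive1E.
have xgd (t : R) : `|t| < e -> is_derive t 1 (fun s => x - g s) (- derive1 g t).
  move=> /gd gt; rewrite -[X in is_derive _ _ _ X]add0r.
  exact: (is_deriveB (is_derive_cst x t 1) gt).
have fd (t : R) : `|t| < e -> is_derive t 1 (fun s => dotp (x - g s) (x - g s))
    (- 2 * dotp (x - g t) (derive1 g t)).
  move=> te; have := is_derive_dotp (xgd t te) (xgd t te).
  by rewrite dotpNl dotpNr dotpC => h; apply: is_derive_eq h _; ring.
have inside (t : R) : t \in `](- e), e[ -> `|t| < e by rewrite in_itv/= ltr_norml.
have [||||_ f0] := @derive1_at_min _ (fun s => dotp (x - g s) (x - g s)) (- e) e 0.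
- by lra.
- by move=> t /inside/fd[].
- by rewrite in_itv/= oppr_lt0 e0.
- move=> t /inside te; rewrite g0 -!sqr_norm2 ler_sqr ?nnegrE ?norm2_ge0// qD.
  by apply: dist_to_le; have [] := gM t te.
have [|_ ] := fd 0; first by rewrite normr0.
rewrite f0 g0 gw => /esym/eqP; rewrite mulf_eq0 => /orP[|/eqP//].
by rewrite oppr_eq0 pnatr_eq0.
Qed.

(** The witness is the image under [Psi] of the line x + t w, which stays in the coordinate subspace
    describing [M]. *)
Lemma chart_tangent (m : nat) V Psi x w : open V -> C1_on V Psi ->
  (forall y, V y -> (M (Psi y) <-> forall i : 'I_d, (m <= i)%N -> y 0 i = 0)) ->
  V x -> M (Psi x) -> (forall i : 'I_d, (m <= i)%N -> w 0 i = 0) ->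
  tangent_space M (Psi x) (w *m 'J Psi x).
Proof.
move=> oV PC1 MP Vx Mx w0.
have [b b0 bV] := (nbhs_ball2P _ _).1 (open_nbhs_nbhs (conj oV Vx)).
have w1 : 0 < norm2 w + 1 by rewrite ltr_wpDl ?norm2_ge0.
pose e := b / (norm2 w + 1); have e0 : 0 < e by rewrite divr_gt0.
have Vt (t : R) : `|t| < e -> V (x + t *: w).
  move=> te; apply: bV; rewrite /ball2 /= addrAC subrr add0r norm2Z.
  rewrite ltr_pdivlMr// in te; apply: le_lt_trans te.
  by rewrite ler_wpM2l// lerDl.
have gd (t : R) : `|t| < e ->
    is_derive t 1 (fun s => Psi (x + s *: w)) (w *m 'J Psi (x + t *: w)).
  by move=> /Vt/PC1[Pd _]; exact: is_derive_line.
have gE (t : R) : `|t| < e -> derive1 (fun s => Psi (x + s *: w)) t = w *m 'J Psi (x + t *: w).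
  by move=> te; rewrite derive1E; have [] := gd t te.
exists (fun s => Psi (x + s *: w)), e; split => //.
- move=> t te; split.
  + apply/MP; first exact: Vt.
    by move=> i mi; rewrite !mxE w0// mulr0 addr0; exact: (MP x Vx).1.
  + by have [] := gd t te.
  + apply/cvgrPdist_lt => k k0.
    pose c := d%:R ^+ 2 * norm2 w + 1.
    have c0 : 0 < c by rewrite ltr_wpDl// mulr_ge0 ?sqr_ge0 ?norm2_ge0.
    have [a a0 aJ] := C1_on_near PC1 (Vt t te) (divr_gt0 k0 c0).
    pose k' := Num.min (e - `|t|) (a / (norm2 w + 1)).
    have k'0 : 0 < k' by rewrite lt_min subr_gt0 te divr_gt0.
    apply: filterS (nbhsx_ballx t _ k'0) => s; rewrite -ball_normE /ball_ /=.
    rewrite lt_min => /andP[se st]; have {}se : `|s| < e.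
      by have := ler_distD t s 0; rewrite !subr0 (distrC s); lra.
    have : `|'J Psi (x + s *: w) - 'J Psi (x + t *: w)| < k / c.
      apply: aJ; rewrite opprD addrACA subrr add0r -scalerBl norm2Z.
      rewrite distrC ltr_pdivlMr// in st *.
      by apply: le_lt_trans st; rewrite ler_wpM2l// lerDl.
    rewrite !gE//; move: ('J Psi (x + s *: w)) ('J Psi (x + t *: w)) => A B.
    rewrite distrC ltr_pdivlMr// -mulmxBr => AB.
    apply: le_lt_trans (mx_norm_le_norm2 _) (le_lt_trans (norm2_mulmx _ _) _).
    by apply: le_lt_trans AB; rewrite mulrAC [leRHS]mulrC ler_wpM2r// lerDl.
- by rewrite scale0r addr0.
- by have := gE 0; rewrite normr0 scale0r addr0; exact.
Qed.

(** For unit t1 along g and any unit t2 in T2, orthogonality gives <v, t1> = <v, t1 - t2> <= |v| |t1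
    - t2|; take the infimum over t2. *)
Lemma dotp_subspace_dist (T1 T2 : set 'rV[R]_d) g v b :
  (forall c, T1 (c *: g)) -> T2 `&` @unit_sphere R d !=set0 ->
  subspace_dist T1 T2 <= b -> (forall u, T2 u -> dotp v u = 0) ->
  dotp v g <= norm2 v * norm2 g * b.
Proof.
move=> T1g [t0 [T2t0 t01]] Tb vT2.
have [->|g0] := eqVneq g 0.
  by rewrite norm20 mulr0 mul0r dotp0r.
have [->|v0] := eqVneq v 0.
  by rewrite norm20 !mul0r dotp0l.
have gg := norm2_gt0 g0; have vv := norm2_gt0 v0.
pose t1 := (norm2 g)^-1 *: g.
have t11 : norm2 t1 = 1 by rewrite norm2Z gtr0_norm ?invr_gt0// mulVf// gt_eqF.
have T1t1 : (T1 `&` @unit_sphere R d) t1 by split; [exact: T1g|exact: t11].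
pose I (t : 'rV[R]_d) := inf [set norm2 (t2 - t) | t2 in T2 `&` @unit_sphere R d].
have lb (t : 'rV[R]_d) : has_inf [set norm2 (t2 - t) | t2 in T2 `&` @unit_sphere R d].
  by split; [exists (norm2 (t0 - t)), t0|exists 0 => _ [z _ <-]; exact: norm2_ge0].
have hI : has_sup [set I t | t in T1 `&` @unit_sphere R d].
  split; first by exists (I t1), t1.
  exists 2 => _ [t [_ tt] <-]; rewrite /unit_sphere /= in tt t01.
  apply: le_trans (ge_inf (lb t).2 _) _; first by exists t0.
  by apply: le_trans (ler_norm2D _ _) _; rewrite norm2N tt t01.
have Ib : I t1 <= b by apply: le_trans Tb; apply: sup_upper_bound => //; exists t1.
have : dotp v t1 / norm2 v <= I t1.
  apply: lb_le_inf (lb t1).1 _ => _ [t [T2t _] <-].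
  have -> : dotp v t1 = dotp v (t1 - t).
    by rewrite (dotpDr t1) dotpNr (vT2 t)// subr0.
  by rewrite ler_pdivrMr// mulrC (dist2C t) cauchy_schwarz.
move=> /le_trans/(_ Ib); rewrite ler_pdivrMr// dotpZr ler_pdivrMl//.
by rewrite mulrC [b * _]mulrC mulrAC.
Qed.

(* Integrate the velocity of the curve t |-> Psi (Phi y + t w), which runs in M
   from y to z: as the tangent spaces are Lipschitz, its component along v is
   O(|z - y|^2). *)
Lemma C11_normal_estimate m x : (1 <= m)%N -> C11_submanifold m M -> M x ->
  exists r K : R, [/\ 0 < r, 0 < K, closure M `&` ball2 x r `<=` M &
    forall y z v, M y -> ball2 x r y -> M z -> ball2 x r z ->
      (forall u, tangent_space M y u -> dotp v u = 0) ->
      dotp v (z - y) <= K * norm2 v * norm2 (z - y) ^+ 2].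
Proof.
move=> m1 [[_ chart] lipT] Mx.
have [U [V [Psi [oU oV Ux [Phi [VU UV PsiC1 PhiC1]] MV]]]] := chart x Mx.
have [W [L [oW Wx L0 WL]]] := lipT x Mx.
have [a1 [K1 [a10 K10 a1V PsiK]]] := C1_on_bound oV PsiC1 (UV _ Ux).1.
have [a2 [K2 [a20 K20 a2U PhiK]]] := C1_on_bound oU PhiC1 Ux.
have PsiL := C1_on_lip PsiC1 a1V PsiK.
have PhiL := C1_on_lip PhiC1 a2U PhiK.
have [b b0 bW] := (nbhs_ball2P _ _).1 (open_nbhs_nbhs (conj oW Wx)).
(* In the chart, radius [c] keeps the Lipschitz bound for [Psi] and sends the ball into [W], where
   tangent spaces are Lipschitz. *)
pose c := Num.min a1 (b / K1).
have c0 : 0 < c by rewrite lt_min a10 divr_gt0.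
have ca1 : ball2 (Phi x) c `<=` ball2 (Phi x) a1.
  by move=> y; rewrite /ball2 /= lt_min => /andP[].
have cW y : ball2 (Phi x) c y -> W (Psi y).
  move=> yc; apply: bW; rewrite /ball2 /= -[X in _ - X](UV x Ux).2.
  apply: le_lt_trans (PsiL _ _ _ (ca1 _ yc)) _; first by rewrite /ball2 /= subrr norm20.
  by rewrite mulrC -ltr_pdivlMr//; move: yc; rewrite /ball2 /= lt_min => /andP[].
pose r := Num.min a2 (c / K2).
have r0 : 0 < r by rewrite lt_min a20 divr_gt0.
have ra2 : ball2 x r `<=` ball2 x a2.
  by move=> y; rewrite /ball2 /= lt_min => /andP[].
have rU y : ball2 x r y -> U y by move=> /ra2/a2U.
have Phir y : ball2 x r y -> ball2 (Phi x) c (Phi y).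
  move=> yr; rewrite /ball2 /=; apply: le_lt_trans (PhiL _ _ _ (ra2 _ yr)) _.
    by rewrite /ball2 /= subrr norm20.
  by rewrite mulrC -ltr_pdivlMr//; move: yr; rewrite /ball2 /= lt_min => /andP[].
have Phi0 y : M y -> ball2 x r y -> forall i : 'I_d, (m <= i)%N -> Phi y 0 i = 0.
  by move=> My /rU Uy; apply/(MV _ (UV _ Uy).1); rewrite (UV _ Uy).2.
(* The velocity is at most K1 |w|, the tangent spaces differ by at most L K1 |w|, and |w| <= K2 |z -
   y|. *)
exists r, (L * K1 ^+ 2 * K2 ^+ 2); split => //.
- by rewrite !mulr_gt0// exprn_gt0.
(* [M] is locally closed: vanishing of the last chart coordinates passes to limits because [Phi] is
   Lipschitz. *)
- move=> y [Cy yr]; have Uy := rU y yr; rewrite -(UV _ Uy).2.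
  apply/(MV _ (UV _ Uy).1) => i mi; apply/eqP; rewrite -normr_le0.
  apply/ler_addgt0Pr => e e0; rewrite add0r.
  have [|z Mz zy] := (closure_ball2P M y).1 Cy (Num.min (e / K2) (r - norm2 (y - x))).
    by rewrite lt_min divr_gt0// subr_gt0.
  move: zy; rewrite lt_min => /andP[ze zr].
  have xzr : ball2 x r z by rewrite /ball2 /=; have := ler_dist2D y z x; lra.
  have := PhiL _ _ (ra2 _ xzr) (ra2 _ yr).
  move=> /(le_trans (mx_norm_le_norm2 _)) h.
  have := coord_le_mx_norm (Phi y - Phi z) 0 i.
  rewrite !mxE (Phi0 z)// subr0 => /le_trans; apply; apply: (le_trans h).
  by rewrite mulrC -ler_pdivlMr// dist2C ltW.
move=> y z v My yr Mz zr vT; pose w := Phi z - Phi y.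
have Uy := rU y yr; have Uz := rU z zr.
have wK : norm2 w <= K2 * norm2 (z - y) by apply: PhiL; exact: ra2.
have w0 (i : 'I_d) : (m <= i)%N -> w 0 i = 0.
  by move=> mi; rewrite !mxE !Phi0// subr0.
have [wE|wN0] := eqVneq w 0.
  have -> : z - y = 0.
    by apply/eqP; rewrite subr_eq0 -(UV z Uz).2 -(UV y Uy).2 (subr0_eq wE).
  by rewrite dotp0r norm20 expr0n mulr0.
have pathc (t : R) : 0 <= t <= 1 -> ball2 (Phi x) c (Phi y + t *: w).
  by move=> t01; apply: ball2_segment => //; exact: Phir.
have pathV (t : R) : 0 <= t <= 1 -> V (Phi y + t *: w) by move=> /pathc/ca1/a1V.
have pathM (t : R) : 0 <= t <= 1 -> M (Psi (Phi y + t *: w)).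
  move=> t01; apply/MV; first exact: pathV.
  by move=> i mi; rewrite mxE Phi0// mxE w0// mulr0 addr0.
have [t t01|t t01] := @mean_value_dotp _ _ v (fun t => Psi (Phi y + t *: w))
    (fun t => w *m 'J Psi (Phi y + t *: w)).
  by apply: is_derive_line; exact: (PsiC1 _ (pathV t t01)).1.
rewrite scale1r scale0r addr0 subrKC (UV z Uz).2 (UV y Uy).2 => ->.
set g := w *m _.
have gK : norm2 g <= K1 * norm2 w by apply: PsiK; apply: ca1; exact: pathc.
have tangent (u : 'rV[R]_d) (s : R) : 0 <= s <= 1 -> (forall i : 'I_d, (m <= i)%N -> u 0 i = 0) ->
    tangent_space M (Psi (Phi y + s *: w)) (u *m 'J Psi (Phi y + s *: w)).
  by move=> s01 u0; apply: (@chart_tangent m V) => //; [exact: pathV|exact: pathM].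
(* A nonzero tangent vector exists: [Phi] inverts [Psi], so the derivative of [Psi] is injective and
   does not kill [w]. *)
have T0 : tangent_space M y `&` @unit_sphere R d !=set0.
  pose g0 := w *m 'J Psi (Phi y).
  have g00 : g0 != 0.
    apply: contra_neq wN0 => g0E.
    have Pd := (PsiC1 _ (UV y Uy).1).1.
    have Pd' : differentiable Phi (Psi (Phi y)).
      by rewrite (UV y Uy).2; exact: (PhiC1 _ Uy).1.
    have := @near_eq_derive _ _ _ (Phi \o Psi) id (Phi y) w.
    rewrite derive_id => <-.
      rewrite deriveE; last exact: differentiable_comp.
      have Pw : 'd Psi (Phi y) w = 0 by rewrite -deriveE// deriveEjacobian.
      rewrite (diff_comp Pd Pd'); change ('d Phi (Psi (Phi y)) ('d Psi (Phi y) w) = 0).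
      have lin0 (D : {linear 'rV[R]_d -> 'rV[R]_d}) u : u = 0 -> D u = 0.
        by move=> ->; rewrite linear0.
      exact: (lin0 ('d Phi (Psi (Phi y))) _ Pw).
    apply: filterS (open_nbhs_nbhs (conj oV (UV y Uy).1)) => s Vs.
    exact: (VU s Vs).2.
  have := tangent ((norm2 g0)^-1 *: w) 0.
  rewrite scale0r addr0 (UV y Uy).2 lexx ler01 => /(_ isT) Tg.
  exists ((norm2 g0)^-1 *: g0); split.
    by rewrite scalemxAl; apply: Tg => i mi; rewrite mxE w0// mulr0.
  rewrite /unit_sphere /= norm2Z gtr0_norm ?invr_gt0 ?norm2_gt0// mulVf//.
  by rewrite gt_eqF// norm2_gt0.
have yt : norm2 (Psi (Phi y + t *: w) - y) <= K1 * norm2 w.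
  rewrite -{2}(UV y Uy).2.
  apply: le_trans (PsiL _ _ (ca1 _ (Phir _ yr)) (ca1 _ (pathc t t01))) _.
  rewrite addrAC subrr add0r norm2Z ler_wpM2l ?(ltW K10)//.
  by case/andP: t01 => t0 t1; rewrite ger0_norm// ler_piMl// norm2_ge0.
have dT : subspace_dist (tangent_space M (Psi (Phi y + t *: w))) (tangent_space M y)
    <= L * (K1 * norm2 w).
  apply: le_trans (WL _ _ _ _) _.
  - by split; [exact: pathM|apply: cW; exact: pathc].
  - by split => //; rewrite -(UV y Uy).2; apply: cW; exact: Phir.
  - by rewrite ler_wpM2l// ltW.
have Tg k : tangent_space M (Psi (Phi y + t *: w)) (k *: g).
  by rewrite scalemxAl; apply: tangent => // i mi; rewrite mxE w0// mulr0.
apply: le_trans (dotp_subspace_dist Tg T0 dT vT) _.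
apply: (@le_trans _ _ (norm2 v * (K1 * norm2 w) * (L * (K1 * norm2 w)))).
  rewrite ler_wpM2r ?mulr_ge0 ?norm2_ge0 ?(ltW L0) ?(ltW K10)//.
  by rewrite ler_wpM2l ?norm2_ge0.
have -> : norm2 v * (K1 * norm2 w) * (L * (K1 * norm2 w)) =
  L * K1 ^+ 2 * norm2 v * norm2 w ^+ 2 by ring.
have -> : L * K1 ^+ 2 * K2 ^+ 2 * norm2 v * norm2 (z - y) ^+ 2 =
  L * K1 ^+ 2 * norm2 v * (K2 * norm2 (z - y)) ^+ 2 by ring.
have LK0 : 0 <= L * K1 ^+ 2 * norm2 v by rewrite !mulr_ge0 ?sqr_ge0 ?norm2_ge0// ltW.
apply: ler_wpM2l => //; rewrite ler_sqr// nnegrE ?norm2_ge0//.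
by rewrite mulr_ge0 ?norm2_ge0// ltW.
Qed.

(** Let p, q be nearest to y, with u = y - q normal at q and w = p - q. Equal distances give |w|^2 =
    2 <u, w> <= 2 K |u| |w|^2, so w = 0 once |u| < 1 / (2 K). *)
Lemma C11_sub_unpp_interior m : (1 <= m)%N -> C11_submanifold m M ->
  M `<=` unpp_interior M.
Proof.
move=> m1 hM x Mx; have M0 : M !=set0 by exists x.
have [r [K [r0 K0 rM est]]] := C11_normal_estimate m1 hM Mx.
pose e := Num.min (r / 2) (1 / (2 * K)).
have e0 : 0 < e by rewrite lt_min !divr_gt0// mulr_gt0.
have er : e <= r / 2 by rewrite ge_min lexx.
have eK : e * (2 * K) <= 1 by rewrite -ler_pdivlMr ?mulr_gt0// ge_min lexx orbT.
apply/nbhs_ball2P; exists e => // y; rewrite /ball2 /= => ye.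
have De : dist_to y M < e by apply: le_lt_trans ye; exact: dist_to_le.
have near q : norm2 (y - q) = dist_to y M -> ball2 x r q.
  by rewrite /ball2 /= => qD; have := ler_dist2D y q x; rewrite (dist2C q y); lra.
have [q Cq qD] := exists_nearest M0 y.
have Mq : M q by apply: rM; split => //; exact: near.
exists q; split => // p [Mp pD].
have := est q p (y - q) Mq (near q qD) Mp (near p pD) (nearest_normal Mq qD).
have : norm2 (y - p) ^+ 2 = norm2 (y - q) ^+ 2 by rewrite pD qD.
have -> : y - p = (y - q) - (p - q) by rewrite opprB addrC subrKA addrC.
move: De; rewrite -qD (sqr_norm2 (_ - (p - q))).
move: (y - q) (p - q) (@subr0_eq _ p q) => u w pq ue.
rewrite !dotpE -!sqr_norm2 (dotpC w u) => h1 h2.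
apply/esym/pq/norm2_eq0/eqP; rewrite -sqrf_eq0; apply/eqP/le_anti.
rewrite sqr_ge0 andbT.
have [->|w0] := eqVneq w 0; first by rewrite norm20 expr0n.
have W0 : 0 < norm2 w ^+ 2 by rewrite exprn_gt0// norm2_gt0.
have : norm2 w ^+ 2 * (1 - 2 * K * norm2 u) <= 0 by lra.
rewrite pmulr_rle0//; have := norm2_ge0 u; nra.
Qed.

(** Provides the initial ball for [dist_to_segment]. A point x + w of M inside it would satisfy
    |w|^2 < 2 t <w, v> <= 2 t K |w|^2, against 2 t K <= 1. *)
Lemma C11_tangent_ball m x v : (1 <= m)%N -> C11_submanifold m M ->
  unit_normal_bundle M (x, v) ->
  exists2 t, 0 < t & t <= dist_to (x + t *: v) M.
Proof.
move=> m1 hM [/= Mx vT v1]; have M0 : M !=set0 by exists x.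
have [r [K [r0 K0 _ est]]] := C11_normal_estimate m1 hM Mx.
pose t := Num.min (r / 2) (1 / (2 * K)).
have t0 : 0 < t by rewrite lt_min !divr_gt0// mulr_gt0.
have tr : t <= r / 2 by rewrite ge_min lexx.
have tK : t * (2 * K) <= 1 by rewrite -ler_pdivlMr ?mulr_gt0// ge_min lexx orbT.
exists t => //; apply/ball2_setC => // y; rewrite /ball2 /= => yt My.
have step : x + t *: v - x = t *: v by rewrite addrAC subrr add0r.
have yr : ball2 x r y.
  rewrite /ball2 /=; have := ler_dist2D (x + t *: v) y x.
  by rewrite step norm2Z v1 mulr1 gtr0_norm//; lra.
have xr : ball2 x r x by rewrite /ball2 /= subrr norm20.
have := est x y v Mx xr My yr vT; rewrite v1 mulr1.
move: yt; rewrite ltNge norm2_ge_sqr ?(ltW t0)// -ltNge opprD addrA.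
move: (y - x) => w; rewrite !dotpE -!sqr_norm2 v1 (dotpC v w) => h1 h2.
have [w0|w0] := ltP 0 (norm2 w ^+ 2); last first.
  have h3 : norm2 w ^+ 2 = 0 by apply/le_anti; rewrite w0 sqr_ge0.
  by move: h1 h2; rewrite h3; nra.
have : t * dotp w v <= t * (K * norm2 w ^+ 2) by rewrite ler_pM2l.
have : t * (2 * K) * norm2 w ^+ 2 <= 1 * norm2 w ^+ 2 by rewrite ler_pM2r.
lra.
Qed.

End Submanifold.

(** * Lower and upper semicontinuity of the frontier function *)

Section Frontier.
Context {R : realType} {d : nat} (M : set 'rV[R]_d).
Implicit Types (x v y : 'rV[R]_d) (p : 'rV[R]_d * 'rV[R]_d) (s t r : R).

Lemma le_frontier_function p r : 0 < r ->
  (forall s, 0 < s < r -> unpp_interior M (p.1 + s *: p.2)) ->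
  (r%:E <= frontier_function M p)%E.
Proof.
move=> r0 rE; apply: ereal_sup_ubound; exists r => //; split => // _ [l /= /andP[l0 l1] <-].
rewrite scalerDr addrA -scalerDl subrK scale1r scalerA; apply: rE.
by rewrite mulr_gt0// gtr_pMl.
Qed.

Lemma lt_frontier_function p t : (t%:E < frontier_function M p)%E ->
  exists r, [/\ t < r, 0 < r &
    open_segment p.1 (p.1 + r *: p.2) `<=` unpp_interior M].
Proof. by move=> /ereal_sup_gt[_ [r [r0 rE] <-]]; rewrite lte_fin; exists r. Qed.

Lemma near_pair_ball2 p (e : R) : 0 < e ->
  \forall q \near p, ball2 p.1 e q.1 /\ ball2 p.2 e q.2.
Proof. by move=> e0; exists (ball2 p.1 e, ball2 p.2 e) => //; split; exact: nbhs_ball2. Qed.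

Lemma frontier_function_near_gt p t : M `<=` unpp_interior M -> M p.1 ->
  (t%:E < frontier_function M p)%E ->
  \forall q \near p, (t%:E < frontier_function M q)%E.
Proof.
move=> ME Mp /lt_frontier_function[r [tr r0 rE]].
(* Stopping at [s < r] makes the segment closed, hence compact; the maximum with 0 covers negative
   [t]. *)
have [s [ts s0 sr]] : exists s, [/\ t < s, 0 < s & s < r].
  exists ((Num.max t 0 + r) / 2).
  have : t <= Num.max t 0 by rewrite le_max lexx.
  have : 0 <= Num.max t 0 by rewrite le_max lexx orbT.
  have : Num.max t 0 < r by rewrite gt_max tr.
  by move=> *; split; lra.
have sE (a : R) : `[0, s]%classic a -> unpp_interior M (p.1 + a *: p.2).
  rewrite /= in_itv/= => /andP[a0 sa].
  have [->|an0] := eqVneq a 0; first by rewrite scale0r addr0; exact: ME.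
  apply: rE; exists (a / r) => /=.
    have a1 : 0 < a by rewrite lt_def an0.
    by rewrite divr_gt0//= ltr_pdivrMr// mul1r (le_lt_trans sa).
  by rewrite scalerDr addrA -scalerDl subrK scale1r scalerA divfK// gt_eqF.
(* Tube lemma: compactness of [0, s] gives one neighbourhood of [p] that works for every [a]. *)
have cover := (compact_near_coveringP `[0, s]).1 (@segment_compact _ 0 s) _ (nbhs p)
  (fun q a => unpp_interior M (q.1 + a *: q.2)) (nbhs_filter p).
apply: filterS (cover _) => [q qE|a as_].
  apply: (@lt_le_trans _ _ s%:E); first by rewrite lte_fin.
  apply: le_frontier_function => // a /andP[a0 sa]; apply: qE.
  by rewrite /= in_itv/= !ltW.
have [e e0 eE] := (nbhs_ball2P _ _).1 (@open_interior _ (unpp M) _ (sE a as_)).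
(* The displacement of q.1 + b q.2 is bounded by c + (|a| + 1) c + c |p.2|, which is below [e]. *)
pose c := e / (3 * (`|a| + 1 + norm2 p.2 + 1)).
have P0 := norm2_ge0 p.2; have A0 : 0 <= `|a| by [].
have c0 : 0 < c by rewrite divr_gt0// mulr_gt0//; lra.
have cE : 3 * (`|a| + 1 + norm2 p.2 + 1) * c = e.
  by rewrite mulrC divfK// gt_eqF// mulr_gt0//; lra.
pose c' := Num.min c 1.
have c'0 : 0 < c' by rewrite lt_min c0 ltr01.
exists (ball a c', [set q | ball2 p.1 c q.1 /\ ball2 p.2 c q.2]).
  by split; [exact: nbhsx_ballx|exact: near_pair_ball2].
move=> [b q] [/=]; rewrite -ball_normE /ball_ /= lt_min => /andP[bc b1] [q1 q2].
apply: eE; rewrite /ball2 /= in q1 q2 *.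
have -> : q.1 + b *: q.2 - (p.1 + a *: p.2) =
    (q.1 - p.1) + (b *: (q.2 - p.2) + (b - a) *: p.2).
  by apply/rowP => i; rewrite !mxE; ring.
apply: le_lt_trans (ler_norm2D _ _) _.
have := ler_norm2D (b *: (q.2 - p.2)) ((b - a) *: p.2); rewrite !norm2Z (distrC b).
have bA : `|b| <= `|a| + 1.
  by have := ler_distD a b 0; rewrite !subr0 (distrC b); lra.
have : `|b| * norm2 (q.2 - p.2) <= (`|a| + 1) * c.
  by rewrite ler_pM ?norm2_ge0// ltW.
have : `|a - b| * norm2 p.2 <= c * norm2 p.2 by rewrite ler_wpM2r// ltW.
nra.
Qed.

Lemma frontier_function_near_lt m p t : (1 <= m)%N -> C11_submanifold m M ->
  closed (skeleton (~` M)) -> unit_normal_bundle M p ->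
  (frontier_function M p < t%:E)%E ->
  \forall q \near p, unit_normal_bundle M q -> (frontier_function M q < t%:E)%E.
Proof.
move=> m1 hM cS [Mp vp v1] pt; have M0 : M !=set0 by exists p.1.
have ME := C11_sub_unpp_interior m1 hM.
have [r [K [r0 _ rM _]]] := C11_normal_estimate m1 hM Mp.
have t0 : 0 < t.
  have [e e0 eE] := (nbhs_ball2P _ _).1 (@open_interior _ (unpp M) _ (ME _ Mp)).
  rewrite -lte_fin; apply: le_lt_trans pt; apply: (@le_trans _ _ e%:E).
    by rewrite lee_fin ltW.
  apply: le_frontier_function => // s /andP[s0 se]; apply: eE.
  by rewrite /ball2 /= addrAC subrr add0r norm2Z v1 mulr1 gtr0_norm.
(* Otherwise all these balls of radius below [t] miss [M]; using the midpoint (s + t) / 2 as the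
   larger ball, the segment up to [t] lies in the interior of [unpp M]. *)
have [s [s0 st sD]] : exists s, [/\ 0 < s, s < t & dist_to (p.1 + s *: p.2) M < s].
  apply: contrapT => h; move: pt; apply/negP; rewrite -leNgt.
  apply: le_frontier_function => // s /andP[s0 st].
  apply: (unpp_interior_off_skeleton M0 cS Mp v1 r0 rM (t := (s + t) / 2)).
    by apply/andP; split; lra.
  by rewrite leNgt; apply/negP => D; apply: h; exists ((s + t) / 2); split => //; lra.
have [y My yp] : exists2 y, M y & norm2 (p.1 + s *: p.2 - y) < s.
  apply: contrapT => h; move: sD; apply/negP; rewrite -leNgt; apply/ball2_setC => // y.
  by rewrite /ball2 /= dist2C => ys My; apply: h; exists y.
(* Moving both components of [p] by less than [c] moves the centre by less than c (1 + s), so [y]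
   stays inside the ball of radius [s]. *)
pose c := (s - norm2 (p.1 + s *: p.2 - y)) / (1 + s).
have s1 : 0 < 1 + s by rewrite addr_gt0.
have c0 : 0 < c by rewrite divr_gt0// subr_gt0.
have cE : c * (1 + s) = s - norm2 (p.1 + s *: p.2 - y) by rewrite divfK// gt_eqF.
apply: filterS (near_pair_ball2 p c0) => q [q1 q2] [Mq vq w1].
apply: (@le_lt_trans _ _ s%:E); last by rewrite lte_fin.
(* An admissible [b > s] at [q] would make the ball of radius [s] miss [M], although it contains
   [y]. *)
apply: ge_ereal_sup => _ [b [b0 bE] <-]; rewrite lee_fin leNgt; apply/negP => sb.
have [|e e0 eD] := @C11_tangent_ball _ _ M m q.1 q.2 m1 hM; first by split.
have := dist_to_segment M0 Mq w1 e0 eD bE (s := s); rewrite s0 sb => /(_ isT).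
apply/negP; rewrite -ltNge; apply: le_lt_trans (dist_to_le _ My) _.
have -> : q.1 + s *: q.2 - y =
    (q.1 - p.1) + (s *: (q.2 - p.2) + (p.1 + s *: p.2 - y)).
  by apply/rowP => i; rewrite !mxE; ring.
apply: le_lt_trans (ler_norm2D _ _) _; rewrite /ball2 /= in q1 q2.
have := ler_norm2D (s *: (q.2 - p.2)) (p.1 + s *: p.2 - y).
rewrite norm2Z gtr0_norm//.
have : s * norm2 (q.2 - p.2) < s * c by rewrite ltr_pM2l.
lra.
Qed.

End Frontier.

(** Combines the two semicontinuities: a neighbourhood of a finite limit contains an interval around
    it, and one of an infinite limit contains a ray. *)
Lemma cvg_ereal_lt (R : realType) (T : Type) (F : set_system T) (f : T -> \bar R)
    (l : \bar R) : Filter F ->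
  (forall s : R, (s%:E < l)%E -> \forall x \near F, (s%:E < f x)%E) ->
  (forall s : R, (l < s%:E)%E -> \forall x \near F, (f x < s%:E)%E) ->
  f x @[x --> F] --> l.
Proof.
move=> FF lo hi A; case: l lo hi => [r| |] lo hi.
- move=> rA; have /nbhs_ballP[e /= e0 eA] : nbhs r (fun y : R => A y%:E) := rA.
  have := hi (r + e); have := lo (r - e); rewrite !lte_fin ltrDl ltrBlDr ltrDl e0.
  move=> /(_ isT) + /(_ isT); apply: filterS2 => x.
  rewrite /= /preimage /=; case: (f x) => [y| |]//; rewrite !lte_fin => ry yr.
  apply: eA; rewrite -ball_normE /ball_ /= ltr_distl; apply/andP; split; lra.
- move=> [s [_ sA]]; have := lo s (ltry s); apply: filterS => x; exact: sA.
- move=> [s [_ sA]]; have := hi s (ltNyr s); apply: filterS => x; exact: sA.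
Qed.

Theorem theorem4 (R : realType) (d m : nat) (hm : (1 <= m)%N) (hmd : (m < d)%N)
    (M : set 'rV[R]_d) (hM : C11_submanifold m M)
    (hS : closed (skeleton (~` M))) :
  {within unit_normal_bundle M, continuous (frontier_function M)}.
Proof.
apply/subspace_continuousP => p np; have [Mp _ _] := np.
apply: cvg_ereal_lt => t pt.
  apply: cvg_within; apply: frontier_function_near_gt pt => //.
  exact: C11_sub_unpp_interior hM.
exact: frontier_function_near_lt hM hS np pt.
Qed.
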